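(* Let $\mathfrak{H},\mathcal{K}$ be complex Hilbert spaces, $\omega\in\mathfrak{H}$ a distinguished unit vector, and let $\mathcal{E}$, $\pi$, $\mathcal{D}(\eta)$, $\phi$, $\psi$ be as defined in the context. Let $\mathcal{A}_1,\mathcal{A}_2$ be two unital subalgebras of $\mathcal{L}(\mathfrak{H})$ which are free with respect to the functional $a\mapsto\langle a\omega,\omega\rangle$ $(=\psi(\pi(a)))$, and let $\eta_1,\eta_2$ be two orthogonal unit vectors of $\mathcal{K}$. Then the algebras $\mathfrak{A}_1=\pi(\mathcal{A}_1)\vee\mathcal{D}(\eta_1)$ and $\mathfrak{A}_2=\pi(\mathcal{A}_2)\vee\mathcal{D}(\eta_2)$ are c-free with respect to $(\phi,\psi)$.
   Context: $\mathcal{L}(V)$ denotes the bounded linear operators on a Hilbert space $V$; inner products are linear in the first variable. Free and c-free: for an algebra with linear functionals $\phi,\psi$ taking value $1$ at the unit, subalgebras $\{\mathcal{B}_i\}_{i\in I}$ are free with respect to $\psi$ if $\psi(x_1\cdots x_n)=0$ whenever $x_j\in\mathcal{B}_{\epsilon(j)}$, $\psi(x_j)=0$ for all $j$, and $\epsilon(k)\neq\epsilon(k+1)$ for $1\le k<n$; they are c-free with respect to $(\phi,\psi)$ if they are free with respect to $\psi$ and, under the same conditions on $x_1,\dots,x_n$, $\phi(x_1\cdots x_n)=\phi(x_1)\cdots\phi(x_n)$. For $\mathfrak{A}_1,\mathfrak{A}_2$ these conditions are read verbatim, without requiring that these algebras contain the identity of $\mathcal{E}$. Space: $\mathcal{T}^0(\mathcal{K})=\bigoplus_{n\ge1}\mathcal{K}^{\otimes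 n}$, $\mathcal{T}(\mathcal{K})=\mathbb{C}\omega_1\oplus\mathcal{T}^0(\mathcal{K})$ with $\|\omega_1\|=1$; $\mathcal{E}=\mathfrak{H}\oplus(\mathfrak{H}\otimes\mathcal{T}(\mathcal{K}))$; $\mathfrak{H}^0=\mathfrak{H}\ominus\mathbb{C}\omega$; $\Omega=\omega\otimes\omega_1\in\mathfrak{H}\otimes\mathcal{T}(\mathcal{K})$. Functionals on $\mathcal{L}(\mathcal{E})$: $\phi(T)=\langle T\Omega,\Omega\rangle$ and $\psi(T)=\langle T\omega,\omega\rangle$, where in the latter $\omega$ is viewed in the first direct summand $\mathfrak{H}$ of $\mathcal{E}$. Embedding $\pi:\mathcal{L}(\mathfrak{H})\to\mathcal{L}(\mathcal{E})$: $\pi(a)$ acts as $a$ on the summand $\mathfrak{H}$, as $a\otimes\mathrm{Id}$ on $\mathfrak{H}\otimes\mathcal{T}^0(\mathcal{K})$, and as $0$ on $\mathfrak{H}\otimes\mathbb{C}\omega_1$. For nonzero $\eta\in\mathcal{K}$, $A^\ast_\eta\in\mathcal{L}(\mathcal{E})$ is given by $A^\ast_\eta\zeta=0$ for $\zeta\in\mathfrak{H}\oplus(\mathfrak{H}^0\otimes\mathcal{T}(\mathcal{K}))$, $A^\ast_\eta(\omega\otimes\omega_1)=\omega\otimes\eta$, $A^\ast_\eta(\omega\otimes\zeta)=\omega\otimes(\eta\otimes\zeta)$ for $\zeta\in\mathcal{T}^0(\mathcal{K})$. $A_{\eta,0}$ is the orthogonal projection onto $\mathbb{C}\Omega$; for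 $n\ge1$, $A_{\eta,n}(\omega\otimes\eta^{\otimes n})=\Omega$ and $A_{\eta,n}\zeta=0$ for $\zeta\perp\omega\otimes\eta^{\otimes n}$. $\mathcal{D}(\eta)$ is the algebra generated by $A^\ast_\eta$ and $\{A_{\eta,n}\}_{n\ge0}$; $\mathcal{B}_1\vee\mathcal{B}_2$ is the subalgebra of $\mathcal{L}(\mathcal{E})$ generated by $\mathcal{B}_1$ and $\mathcal{B}_2$. *)

(* Defs.v *)
From HB Require Import structures.
From mathcomp Require Import all_boot all_order all_algebra sesquilinear complex.
From mathcomp Require Import all_classical all_reals all_analysis.

Set Implicit Arguments.
Unset Strict Implicit.
Unset Printing Implicit Defensive.

Import Order.TTheory GRing.Theory Num.Theory.
Import numFieldNormedType.Exports.

Local Open Scope classical_set_scope.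
Local Open Scope ring_scope.
Local Open Scope complex_scope.

(* The form of type {dot _ for conj} is linear in its first argument and
   conjugate-linear in its second one. *)
Record hilbert (R : realType) := Hilbert {
  hilbert_sort :> completeNormedModType R[i];
  hilbert_dot : {dot hilbert_sort for (@Num.conj R[i])};
  hilbert_normE : forall x : hilbert_sort, `|x| ^+ 2 = hilbert_dot x x }.

Definition dot (R : realType) (V : hilbert R) (x y : V) : R[i] :=
  hilbert_dot V x y.

Definition lin_span (R : realType) (V : hilbert R) (S : set V) : set V :=
  [set v | exists (n : nat) (c : 'I_n -> R[i]) (x : 'I_n -> V),
     (forall i, S (x i)) /\ v = \sum_(i < n) c i *: x i].

Definition total_set (R : realType) (V : hilbert R) (S : set V) : Prop :=
  dense (lin_span S).

(* Hilbert space tensor products and Hilbert sums are determined up to a unique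
   unitary compatible with the structure maps; the three records below are the
   types of their realizations. *)

Record tensor_product (R : realType) (V W : hilbert R) := TensorProduct {
  tp_space :> hilbert R;
  tp_map : {bilinear V -> W -> tp_space};
  tp_dot : forall (v v' : V) (w w' : W),
    dot (tp_map v w) (tp_map v' w') = dot v v' * dot w w';
  tp_total : total_set [set tp_map p.1 p.2 | p in [set: V * W]] }.

(* V^{(x) n}; for n = 0 this is the line spanned by the unit vector
   [tpow_map [tuple]], since the empty product of scalars is 1. *)
Record tensor_power (R : realType) (V : hilbert R) (n : nat) := TensorPower {
  tpow_space :> hilbert R;
  tpow_map : n.-tuple V -> tpow_space;
  tpow_multilinear : forall (i : 'I_n) (x : n.-tuple V),
    linear (fun y : V => tpow_map [tuple if j == i then y else tnth x j | j < n]);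
  tpow_dot : forall x y : n.-tuple V,
    dot (tpow_map x) (tpow_map y) = \prod_(i < n) dot (tnth x i) (tnth y i);
  tpow_total : total_set (range tpow_map) }.

Record hilbert_sum (R : realType) (I : Type) (V : I -> hilbert R) := HilbertSum {
  hsum_space :> hilbert R;
  hsum_inj : forall i, {linear V i -> hsum_space};
  hsum_isometry : forall i (x y : V i),
    dot (hsum_inj i x) (hsum_inj i y) = dot x y;
  hsum_orthogonal : forall i j (x : V i) (y : V j),
    i <> j -> dot (hsum_inj i x) (hsum_inj j y) = 0;
  hsum_total : total_set [set z | exists i (x : V i), z = hsum_inj i x] }.

Definition direct_sum (R : realType) (V W : hilbert R) : Type :=
  hilbert_sum (fun b : bool => if b then V else W).

Definition inl_ds (R : realType) (V W : hilbert R) (S : direct_sum V W)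
  (v : V) : S := hsum_inj S true v.

Definition inr_ds (R : realType) (V W : hilbert R) (S : direct_sum V W)
  (w : W) : S := hsum_inj S false w.

(* The full Fock space T(V) = C omega_1 (+) (+)_{n >= 1} V^{(x) n}, where
   C omega_1 is V^{(x) 0}. *)
Record fock_space (R : realType) (V : hilbert R) := FockSpace {
  fock_pow : forall n, tensor_power V n;
  fock_sum :> hilbert_sum (fun n => fock_pow n : hilbert R) }.

(* x_1 (x) ... (x) x_n, as a vector of the full Fock space *)
Definition fock_tensor (R : realType) (V : hilbert R) (T : fock_space V)
    (n : nat) (x : n.-tuple V) : T :=
  hsum_inj T n (tpow_map (fock_pow T n) x).

Definition vacuum (R : realType) (V : hilbert R) (T : fock_space V) : T :=
  fock_tensor T [tuple].

Definition bounded_operator (R : realType) (V : hilbert R) (f : V -> V) : Prop :=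
  linear f /\ exists M : R[i], forall x, `|f x| <= M * `|x|.

(* Subalgebras of L(V), not required to contain the identity *)
Definition subalgebra (R : realType) (V : hilbert R) (A : set (V -> V)) : Prop :=
  [/\ forall a, A a -> bounded_operator a,
      A (fun=> 0),
      forall a b, A a -> A b -> A (fun x => a x + b x),
      forall (c : R[i]) a, A a -> A (fun x => c *: a x) &
      forall a b, A a -> A b -> A (a \o b)].

Definition unital_subalgebra (R : realType) (V : hilbert R) (A : set (V -> V)) :
  Prop := subalgebra A /\ A id.

Definition algebra_gen (R : realType) (V : hilbert R) (S : set (V -> V)) :
  set (V -> V) := smallest (@subalgebra R V) S.

Definition vector_functional (R : realType) (V : hilbert R) (xi : V)
  (f : V -> V) : R[i] := dot (f xi) xi.

(* x_0 x_1 ... x_(n-1) *)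
Definition op_prod (R : realType) (V : hilbert R) (n : nat)
  (x : nat -> V -> V) : V -> V :=
  \big[(fun f g : V -> V => f \o g)/id]_(j < n) x j.

Definition alternating_centered (R : realType) (V : hilbert R)
    (psi : (V -> V) -> R[i]) (I : Type) (B : I -> set (V -> V))
    (n : nat) (eps : nat -> I) (x : nat -> V -> V) : Prop :=
  [/\ (0 < n)%N,
      forall j, (j < n)%N -> B (eps j) (x j),
      forall j, (j < n)%N -> psi (x j) = 0 &
      forall k, (k.+1 < n)%N -> eps k <> eps k.+1].

Definition free_family (R : realType) (V : hilbert R) (psi : (V -> V) -> R[i])
    (I : Type) (B : I -> set (V -> V)) : Prop :=
  forall n eps x, alternating_centered psi B n eps x ->
    psi (op_prod n x) = 0.

Definition cfree_family (R : realType) (V : hilbert R) (phi psi : (V -> V) -> R[i])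
    (I : Type) (B : I -> set (V -> V)) : Prop :=
  free_family psi B /\
  forall n eps x, alternating_centered psi B n eps x ->
    phi (op_prod n x) = \prod_(j < n) phi (x j).

Section Operators.

Context (R : realType) (H K : hilbert R) (omega : H) (T : fock_space K)
  (HT : tensor_product H T) (E : direct_sum H HT).

(* h (x) t, in the second summand of E *)
Definition etensor (h : H) (t : T) : E := inr_ds E (tp_map HT h t).

Definition Omega : E := etensor omega (vacuum T).

(* The three predicates below are the defining properties of pi(a), A^*_eta and
   A_{eta,n}. The elementary tensors occurring in them are total in the
   corresponding subspaces, so that each bounded operator is unique; the
   orthogonal complement of omega_1 in T(K) is T^0(K). *)

Definition is_pi (a : H -> H) (P : E -> E) : Prop :=
  [/\ bounded_operator P,
      forall h : H, P (inl_ds E h) = inl_ds E (a h),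
      forall (h : H) (t : T), dot t (vacuum T) = 0 ->
        P (etensor h t) = etensor (a h) t &
      forall h : H, P (etensor h (vacuum T)) = 0].

(* For n = 0, the last clause reads
   A^*_eta (omega (x) omega_1) = omega (x) eta. *)
Definition is_creation (eta : K) (A : E -> E) : Prop :=
  [/\ bounded_operator A,
      forall h : H, A (inl_ds E h) = 0,
      forall (h : H) (t : T), dot h omega = 0 -> A (etensor h t) = 0 &
      forall (n : nat) (x : n.-tuple K),
        A (etensor omega (fock_tensor T x)) =
        etensor omega (fock_tensor T [tuple of eta :: x])].

(* For n = 0, eta^{(x) 0} = omega_1 and this is the orthogonal projection onto
   C Omega. *)
Definition is_annihilation (eta : K) (n : nat) (A : E -> E) : Prop :=
  [/\ bounded_operator A,
      A (etensor omega (fock_tensor T [tuple of nseq n eta])) = Omega &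
      forall z : E,
        dot z (etensor omega (fock_tensor T [tuple of nseq n eta])) = 0 ->
        A z = 0].

Definition pi_image (A : set (H -> H)) : set (E -> E) :=
  [set P | exists2 a, A a & is_pi a P].

Definition algD (eta : K) : set (E -> E) :=
  algebra_gen [set A | is_creation eta A \/ exists n, is_annihilation eta n A].

Definition algJoin (B1 B2 : set (E -> E)) : set (E -> E) :=
  algebra_gen (B1 `|` B2).

Definition frakA (A : set (H -> H)) (eta : K) : set (E -> E) :=
  algJoin (pi_image A) (algD eta).

End Operators.

Arguments etensor {R H K T HT} E h t.
Arguments Omega {R H K} omega {T HT} E.
Arguments is_pi {R H K T HT} E a P.
Arguments is_creation {R H K} omega {T HT} E eta A.
Arguments is_annihilation {R H K} omega {T HT} E eta n A.
Arguments pi_image {R H K T HT} E A.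
Arguments algD {R H K} omega {T HT} E eta.
Arguments algJoin {R H K T HT} E B1 B2.
Arguments frakA {R H K} omega {T HT} E A eta.

(* Main.v *)
(* Every x in the i-th algebra leaves H invariant, and acts there as some a in
   A_i; this gives freeness for psi. For phi, x Omega = phi(x) Omega + v, where v
   is a combination of vectors (b omega) (x) eta_i^{(x) k} with k >= 1 and
   b in A_i. An annihilation operator only sees pure powers of its own eta, so an
   alternating centered product can bring v back to Omega only through H, that is
   through inner products <c a_1 ... a_m b omega, omega> with b, c in A_i and
   a_1, ..., a_m alternating and centered, starting and ending in the other
   algebra; these vanish by freeness. Hence
   phi(x_1 ... x_n) = phi(x_1 ... x_(n-1)) phi(x_n). *)
Require Import Defs.
From mathcomp Require Import all_boot all_order all_algebra sesquilinear complex.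
From mathcomp Require Import all_classical all_reals all_analysis.

Set Implicit Arguments.
Unset Strict Implicit.
Unset Printing Implicit Defensive.

Import Order.TTheory GRing.Theory Num.Theory.
Import numFieldNormedType.Exports.

Local Open Scope classical_set_scope.
Local Open Scope ring_scope.

(** * Inner product identities *)

Section InnerProduct.

Context (R : realType) (V : hilbert R).
Implicit Types x y z : V.

Lemma dot0l y : dot 0 y = 0.
Proof. by rewrite /dot linear0l. Qed.

Lemma dotDl x y z : dot (x + y) z = dot x z + dot y z.
Proof. by rewrite /dot linearDl. Qed.

Lemma dotZl c x y : dot (c *: x) y = c * dot x y.
Proof. by rewrite /dot linearZl_LR. Qed.

Lemma dot_eq0C x y : dot x y = 0 -> dot y x = 0.
Proof. by rewrite /dot => /eqP; rewrite herm_eq0C => /eqP. Qed.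

Lemma dot_unit x : `|x| = 1 -> dot x x = 1.
Proof. by rewrite /dot -hilbert_normE => ->; rewrite expr1n. Qed.

Lemma dot_sub_proj x y : dot y y = 1 -> dot (x - dot x y *: y) y = 0.
Proof. by move=> yy; rewrite -scaleNr dotDl dotZl yy mulr1 subrr. Qed.

End InnerProduct.

(** * Algebraic linear spans *)

Section LinearHull.

Context (R : realType).

(** An inductive form of the span, so that proofs treat one term at a time instead of the indexed
    sums of [lin_span]. *)
Inductive hull (V : hilbert R) (S : set V) : V -> Prop :=
| hull0 : hull S 0
| hullP (c : R[i]) u v : S u -> hull S v -> hull S (c *: u + v).

Lemma hull_lin (V : hilbert R) (S : set V) (c : R[i]) u v :
  hull S u -> hull S v -> hull S (c *: u + v).
Proof.
move=> hu hv; elim: hu => [|d u' v' Su' _ IH]; first by rewrite scaler0 add0r.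
by rewrite scalerDr scalerA -addrA; apply: hullP.
Qed.

Lemma sub_hull (V : hilbert R) (S : set V) u : S u -> hull S u.
Proof.
by move=> Su; rewrite -[u]addr0 -[u]scale1r; apply: hullP => //; apply: hull0.
Qed.

Lemma hullD (V : hilbert R) (S : set V) u v :
  hull S u -> hull S v -> hull S (u + v).
Proof. by move=> hu hv; rewrite -[u]scale1r; apply: hull_lin. Qed.

Lemma hullZ (V : hilbert R) (S : set V) c u : hull S u -> hull S (c *: u).
Proof. by move=> hu; rewrite -[_ *: _]addr0; apply: hull_lin => //; apply: hull0. Qed.

Lemma hull_sub (V : hilbert R) (S S' : set V) u :
  S `<=` S' -> hull S u -> hull S' u.
Proof.
move=> sub; elim=> [|c u' v Su' _ IH]; first exact: hull0.
by apply: hullP => //; apply: sub.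
Qed.

(** Isolates the coefficient of [u]; with [u] equal to [Omega] it yields the splitting $x\Omega =
    c\Omega + v$. *)
Lemma hull_insert (V : hilbert R) (S : set V) u v :
  hull (S `|` [set u]) v -> exists c, exists2 w, hull S w & v = c *: u + w.
Proof.
elim=> [|c s v' [Ss|->] _ [d [w hw ->]]].
- by exists 0, 0; [apply: hull0 | rewrite scale0r addr0].
- exists d, (c *: s + w); first exact: hullP.
  by rewrite addrCA.
- by exists (c + d), w => //; rewrite scalerDl addrA.
Qed.

Lemma linear_fun0 (V W : hilbert R) (f : V -> W) : linear f -> f 0 = 0.
Proof. by move=> lf; have := lf (-1) 0 0; rewrite scaler0 addr0 scaleN1r addNr. Qed.

Lemma linear_funD (V W : hilbert R) (f : V -> W) u v :
  linear f -> f (u + v) = f u + f v.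
Proof. by move=> lf; have := lf 1 u v; rewrite !scale1r. Qed.

Lemma linear_funZ (V W : hilbert R) (f : V -> W) c u :
  linear f -> f (c *: u) = c *: f u.
Proof. by move=> lf; have := lf c u 0; rewrite (linear_fun0 lf) !addr0. Qed.

Lemma hull_map (V W : hilbert R) (f : V -> W) (S : set V) (S' : set W) u :
  linear f -> (forall s, S s -> hull S' (f s)) -> hull S u -> hull S' (f u).
Proof.
move=> lf fS; elim=> [|c u' v Su' _ IH].
  by rewrite (linear_fun0 lf); apply: hull0.
by rewrite lf; apply: hull_lin => //; apply: fS.
Qed.

Lemma hull_dot0 (V : hilbert R) (S : set V) z u :
  (forall s, S s -> dot s z = 0) -> hull S u -> dot u z = 0.
Proof.
move=> S0; elim=> [|c u' v Su' _ IH]; first exact: dot0l.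
by rewrite dotDl dotZl IH (S0 _ Su') mulr0 addr0.
Qed.

End LinearHull.

(** * Bounded operators, generated algebras and products *)

Section Operators.

Context (R : realType) (V : hilbert R).

(** On the zero space any complex [M] is a bound, so nonnegativity is obtained by passing to its
    modulus. Bounding a composition relies on it. *)
Lemma bounded_operatorP (f : V -> V) : bounded_operator f ->
  linear f /\ exists2 M : R[i], 0 <= M & forall x, `|f x| <= M * `|x|.
Proof.
case=> lf [M fM]; split => //; exists `|M| => // x.
have Mx0 : 0 <= M * `|x| := le_trans (normr_ge0 _) (fM x).
by rewrite -[`|x|]normr_id -normrM ger0_norm.
Qed.

Lemma bounded_operator0 : bounded_operator (fun _ : V => 0).
Proof.
split; first by move=> c u v; rewrite scaler0 addr0.
by exists 0 => x; rewrite normr0 mul0r.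
Qed.

Lemma bounded_operatorD (f g : V -> V) : bounded_operator f ->
  bounded_operator g -> bounded_operator (fun x => f x + g x).
Proof.
case=> lf [M fM] [lg [N gN]]; split.
  by move=> c u v; rewrite lf lg scalerDr addrACA.
exists (M + N) => x; rewrite mulrDl.
exact: le_trans (ler_normD _ _) (lerD (fM x) (gN x)).
Qed.

Lemma bounded_operatorZ (c : R[i]) (f : V -> V) : bounded_operator f ->
  bounded_operator (fun x => c *: f x).
Proof.
case=> lf [M fM]; split.
  by move=> d u v; rewrite lf scalerDr !scalerA mulrC.
by exists (`|c| * M) => x; rewrite normrZ -mulrA ler_wpM2l.
Qed.

Lemma bounded_operator_comp (f g : V -> V) : bounded_operator f ->
  bounded_operator g -> bounded_operator (f \o g).
Proof.
move=> /bounded_operatorP[lf [M M0 fM]] [lg [N gN]]; split.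
  by move=> c u v; rewrite /= lg lf.
exists (M * N) => x /=; rewrite -mulrA.
exact: le_trans (fM _) (ler_wpM2l M0 (gN x)).
Qed.

(** The bounded operators satisfying [P] form a subalgebra containing [S]. Boundedness is carried
    along to supply linearity in the closure steps. *)
Lemma algebra_gen_ind (S : set (V -> V)) (P : (V -> V) -> Prop) :
  (forall f, S f -> bounded_operator f) ->
  (forall f, S f -> P f) ->
  P (fun=> 0) ->
  (forall f g, bounded_operator f -> bounded_operator g ->
    P f -> P g -> P (fun x => f x + g x)) ->
  (forall c f, bounded_operator f -> P f -> P (fun x => c *: f x)) ->
  (forall f g, bounded_operator f -> bounded_operator g ->
    P f -> P g -> P (f \o g)) ->
  forall f, algebra_gen S f -> bounded_operator f /\ P f.
Proof.
move=> Sb SP P0 PD PZ PM f.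
move/(_ (fun f => bounded_operator f /\ P f)); apply; split.
  split => [g []//||g h [? ?] [? ?]|c g [? ?]|g h [? ?] [? ?]]; split.
  - exact: bounded_operator0.
  - exact: P0.
  - exact: bounded_operatorD.
  - exact: PD.
  - exact: bounded_operatorZ.
  - exact: PZ.
  - exact: bounded_operator_comp.
  - exact: PM.
by move=> g Sg; split; [apply: Sb | apply: SP].
Qed.

Lemma op_prod0 (x : nat -> V -> V) : op_prod 0 x = id.
Proof. by rewrite /op_prod big_ord0. Qed.

Lemma op_prodSl n (x : nat -> V -> V) :
  op_prod n.+1 x = x 0%N \o op_prod n (x \o succn).
Proof. by rewrite /op_prod big_ord_recl. Qed.

Lemma op_prodSr n (x : nat -> V -> V) :
  op_prod n.+1 x = op_prod n x \o x n.
Proof.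
elim: n x => [|n IH] x; first by rewrite op_prodSl !op_prod0.
by rewrite op_prodSl IH [in RHS]op_prodSl.
Qed.

Lemma eq_op_prod n (x y : nat -> V -> V) :
  (forall j, (j < n)%N -> x j = y j) -> op_prod n x = op_prod n y.
Proof. by move=> xy; apply: eq_bigr => j _; apply: xy. Qed.

Lemma linear_op_prod n (x : nat -> V -> V) :
  (forall j, (j < n)%N -> linear (x j)) -> linear (op_prod n x).
Proof.
elim: n x => [|n IH] x lx c u v; first by rewrite op_prod0.
by rewrite op_prodSl /= (IH (x \o succn)) ?lx// => j jn; apply: lx.
Qed.

End Operators.

(** * Free words with uncentered letters at the ends *)

Section FreeWords.

Context (R : realType) (H : hilbert R) (omega : H) (A : bool -> set (H -> H)).
Hypothesis omega1 : dot omega omega = 1.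
Hypothesis A_unital : forall i, unital_subalgebra (A i).
Hypothesis A_free : free_family (vector_functional omega) A.

Lemma unital_bounded i a : A i a -> bounded_operator a.
Proof. by case: (A_unital i) => -[+ _ _ _ _] _; apply. Qed.

Lemma unital_linear i a : A i a -> linear a.
Proof. by case/unital_bounded. Qed.

Definition centering (a : H -> H) : H -> H :=
  fun h => a h + (- dot (a omega) omega) *: h.

Lemma centering_mem i a : A i a -> A i (centering a).
Proof.
case: (A_unital i) => -[_ _ AD AZ _] Aid Aa.
exact: (AD a _ Aa (AZ (- dot (a omega) omega) id Aid)).
Qed.

Lemma dot_centering a : dot (centering a omega) omega = 0.
Proof. by rewrite dotDl dotZl omega1 mulr1 subrr. Qed.

Lemma centeringK a h : a h = centering a h + dot (a omega) omega *: h.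
Proof. by rewrite /centering scaleNr subrK. Qed.

(** Write [b] as [centering b] plus a scalar. The scalar part leaves the word [a], the centered part
    lengthens it by one alternating centered letter; freeness kills both. *)
Lemma free_word_last n eps a i b :
  alternating_centered (vector_functional omega) A n eps a ->
  eps n.-1 = ~~ i -> A i b -> dot (op_prod n a (b omega)) omega = 0.
Proof.
move=> alt epsn Ab; have [n0 Aa a0 alte] := alt.
have la : linear (op_prod n a).
  by apply: linear_op_prod => j jn; apply: unital_linear (Aa j jn).
rewrite (centeringK b) (linear_funD _ _ la) linear_funZ// dotDl dotZl.
rewrite [dot (op_prod n a omega) omega](A_free alt) mulr0 addr0.
pose eps' j := if (j < n)%N then eps j else i.
pose a' j := if (j < n)%N then a j else centering b.
have : alternating_centered (vector_functional omega) A n.+1 eps' a'.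
  rewrite /eps' /a'; split => // [j _|j _|k].
  - by case: ltnP => [jn|_]; [apply: Aa | apply: centering_mem].
  - by case: ltnP => [jn|_]; [apply: a0 | apply: dot_centering].
  - rewrite ltnS => kn; rewrite kn; case: ltnP => [|nk]; first exact: alte.
    (* Only the junction is left, where the labels are [~~ i] and [i]. *)
    have -> : k = n.-1.
      apply/eqP; rewrite eqn_leq.
      by case: (n) kn nk n0 => //= m; rewrite !ltnS => -> ->.
    by rewrite epsn; case: (i).
move=> /A_free; rewrite /vector_functional op_prodSr /= /a' ltnn.
by rewrite (eq_op_prod (y := a))// => j ->.
Qed.

(** Split [c] in the same way: the scalar part is [free_word_last] for [a], the centered part is
    [free_word_last] for the word with [centering c] put in front. *)
Lemma free_word_two_sided n eps a i b c :
  alternating_centered (vector_functional omega) A n eps a ->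
  eps 0%N = ~~ i -> eps n.-1 = ~~ i -> A i b -> A i c ->
  dot (c (op_prod n a (b omega))) omega = 0.
Proof.
move=> alt eps0 epsn Ab Ac; have [n0 Aa a0 alte] := alt.
rewrite (centeringK c) dotDl dotZl (free_word_last alt epsn Ab) mulr0 addr0.
pose eps' j := if j is k.+1 then eps k else i.
pose a' j := if j is k.+1 then a k else centering c.
have alt' : alternating_centered (vector_functional omega) A n.+1 eps' a'.
  split => //= [[|j] jn|[|j] jn|[|k] kn] /=.
  - exact: centering_mem.
  - exact: Aa.
  - exact: dot_centering.
  - exact: a0.
  - by rewrite eps0; case: (i).
  - exact: alte.
have := free_word_last (i := i) alt' _ Ab; rewrite op_prodSl; apply.
by case: (n) n0 epsn.
Qed.

End FreeWords.

(** * Word vectors of [E] and the action of the generators on them *)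

Section FockWords.

Context (R : realType) (H K : hilbert R) (omega : H) (T : fock_space K).
Context (HT : tensor_product H T) (E : direct_sum H HT) (eta : bool -> K).
Hypothesis omega1 : dot omega omega = 1.
Hypothesis eta_orthonormal : forall i j, dot (eta i) (eta j) = (i == j)%:R.

(** Tuples whose lengths are only provably equal have different types; comparing the underlying
    sequences avoids transports. *)
Lemma fock_tensor_cast n m (x : n.-tuple K) (y : m.-tuple K) :
  x = y :> seq K -> fock_tensor T x = fock_tensor T y.
Proof.
move=> xy; have nm : n = m by rewrite -(size_tuple x) xy size_tuple.
by case: m / nm y xy => y xy; congr fock_tensor; apply: val_inj.
Qed.

Definition fock_word (w : seq bool) : T := fock_tensor T (in_tuple (map eta w)).

Lemma fock_word_nil : fock_word [::] = vacuum T.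
Proof. exact: fock_tensor_cast. Qed.

(** Words of different lengths lie in orthogonal summands; for equal lengths, a position where the
    letters differ gives a zero factor. *)
Lemma dot_fock_word w w' : dot (fock_word w) (fock_word w') = (w == w')%:R.
Proof.
rewrite /fock_word.
case: (eqVneq (size w') (size w)) => [sww'|nsww']; last first.
  rewrite (_ : (w == w') = false); last first.
    by apply/eqP => ww'; rewrite ww' eqxx in nsww'.
  apply: hsum_orthogonal; rewrite !size_map => /esym/eqP.
  by rewrite (negbTE nsww').
have sz : size (map eta w') == size (map eta w) by rewrite !size_map sww'.
rewrite (@fock_tensor_cast _ _ (in_tuple (map eta w')) (Tuple sz))//.
rewrite /fock_tensor hsum_isometry tpow_dot.
under eq_bigr do rewrite !(tnth_nth 0)/=.
rewrite (eq_bigr (fun i : 'I_(size (map eta w)) =>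
    (nth true w i == nth true w' i)%:R)); last first.
  move=> [i /= iw] _; rewrite size_map in iw.
  by rewrite !(nth_map true) ?sww'// eta_orthonormal.
have [->|neq] := eqVneq w w'; first by rewrite big1// => i _; rewrite eqxx.
have [i iw nwi] : exists2 i, (i < size w)%N & nth true w i != nth true w' i.
  apply: contrapT => /forall2NP nex; move/eqP: neq; apply.
  apply: (@eq_from_nth _ true); first by rewrite sww'.
  by move=> i iw; case: (nex i) => // /negP; rewrite negbK => /eqP.
have iw' : (i < size (map eta w))%N by rewrite size_map.
by rewrite (bigD1 (Ordinal iw'))//= (negbTE nwi) mul0r.
Qed.

Definition ew (h : H) (w : seq bool) : E := etensor E h (fock_word w).

Lemma Omega_ew : Omega omega E = ew omega [::].
Proof. by rewrite /ew fock_word_nil. Qed.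

Lemma dot_ew h h' w w' : dot (ew h w) (ew h' w') = dot h h' * (w == w')%:R.
Proof.
rewrite -dot_fock_word -(tp_dot HT).
exact: (@hsum_isometry _ _ _ E false).
Qed.

Lemma inl_ds_linear : linear (inl_ds E).
Proof.
by move=> c x y; have h := @GRing.linearP _ _ _ _ (hsum_inj E true) c x y.
Qed.

Lemma inr_ds_linear : linear (inr_ds E).
Proof.
by move=> c x y; have h := @GRing.linearP _ _ _ _ (hsum_inj E false) c x y.
Qed.

Lemma ew_linear w : linear (ew ^~ w).
Proof.
by move=> c u v; rewrite /ew /etensor linearPl; apply: inr_ds_linear.
Qed.

Lemma dot_inl_inl h h' : dot (inl_ds E h) (inl_ds E h') = dot h h'.
Proof. exact: hsum_isometry. Qed.

Lemma dot_inl_ew h h' w : dot (inl_ds E h) (ew h' w) = 0.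
Proof. exact: hsum_orthogonal. Qed.

Lemma is_pi_ew a P : is_pi E a P -> forall h w, w != [::] ->
  P (ew h w) = ew (a h) w.
Proof.
case=> _ _ Pt _ h w w0; apply: Pt.
by rewrite -fock_word_nil dot_fock_word (negbTE w0).
Qed.

Lemma is_pi_Omega a P : is_pi E a P -> P (Omega omega E) = 0.
Proof. by case=> _ _ _ ->. Qed.

(** Split [h] along [omega]: the part orthogonal to [omega] is killed. *)
Lemma is_creation_ew i P : is_creation omega E (eta i) P -> forall h w,
  P (ew h w) = dot h omega *: ew omega (i :: w).
Proof.
case=> -[lP _] _ P0 Pt h w; pose h0 := h - dot h omega *: omega.
have -> : h = dot h omega *: omega + h0 by rewrite addrC subrK.
rewrite ew_linear lP {2}/ew P0 ?dot_sub_proj//.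
rewrite addr0 /ew Pt dotDl dotZl omega1 mulr1 dot_sub_proj// addr0.
by congr (_ *: etensor _ _ _); apply: fock_tensor_cast.
Qed.

(** Removing from [z] its projection onto a unit vector leaves a vector that [P] kills, so [P] has
    rank one. *)
Lemma is_annihilation_dot i n P : is_annihilation omega E (eta i) n P ->
  forall z, P z = dot z (ew omega (nseq n i)) *: Omega omega E.
Proof.
have eti : fock_tensor T [tuple of nseq n (eta i)] = fock_word (nseq n i).
  by apply: fock_tensor_cast; rewrite /= map_nseq.
case=> -[lP _]; rewrite eti -/(ew _ _) => P1 P0 z.
set u := ew _ _ in P1 P0 *.
have uu : dot u u = 1 by rewrite dot_ew omega1 eqxx mulr1.
rewrite -[z in LHS](subrK (dot z u *: u)) (linear_funD _ _ lP).
rewrite P0 ?dot_sub_proj//.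
by rewrite add0r (linear_funZ _ _ lP) P1.
Qed.

Lemma is_annihilation_ew i n P : is_annihilation omega E (eta i) n P ->
  forall h w, P (ew h w) = (dot h omega * (w == nseq n i)%:R) *: Omega omega E.
Proof. by move=> /is_annihilation_dot Pz h w; rewrite Pz dot_ew. Qed.

Lemma is_annihilation_inl i n P : is_annihilation omega E (eta i) n P ->
  forall h, P (inl_ds E h) = 0.
Proof. by move=> /is_annihilation_dot Pz h; rewrite Pz dot_inl_ew scale0r. Qed.

End FockWords.

(** * The two algebras acting on word vectors *)

Section Compression.

Context (R : realType) (H K : hilbert R) (omega : H) (T : fock_space K).
Context (HT : tensor_product H T) (E : direct_sum H HT) (eta : bool -> K).
Context (A : bool -> set (H -> H)).
Hypothesis omega1 : dot omega omega = 1.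
Hypothesis eta_orthonormal : forall i j, dot (eta i) (eta j) = (i == j)%:R.
Hypothesis A_unital : forall i, unital_subalgebra (A i).

Local Notation ew := (ew E eta).
Local Notation frak i := (frakA omega E (A i) (eta i)).

(** Two nested uses of [algebra_gen_ind], the inner one for [algD], reduce the generators to the
    three basic kinds. *)
Lemma frak_ind i (P : (E -> E) -> Prop) :
  (forall a f, A i a -> is_pi E a f -> P f) ->
  (forall f, is_creation omega E (eta i) f -> P f) ->
  (forall n f, is_annihilation omega E (eta i) n f -> P f) ->
  P (fun=> 0) ->
  (forall f g, bounded_operator f -> bounded_operator g ->
    P f -> P g -> P (fun x => f x + g x)) ->
  (forall c f, bounded_operator f -> P f -> P (fun x => c *: f x)) ->
  (forall f g, bounded_operator f -> bounded_operator g ->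
    P f -> P g -> P (f \o g)) ->
  forall f, frak i f -> bounded_operator f /\ P f.
Proof.
move=> Ppi Pcr Pan P0 PD PZ PM.
have DP f : algD omega E (eta i) f -> bounded_operator f /\ P f.
  apply: algebra_gen_ind => // {}f [cr|[n an]].
  - by case: cr.
  - by case: an.
  - exact: Pcr.
  - exact: Pan an.
apply: algebra_gen_ind => // f [[a Aa pif]|/DP[]//].
- by case: pif.
- exact: Ppi pif.
Qed.

(** A sink: annihilation operators see only pure powers, so the span of these vectors is invariant
    under both algebras and orthogonal to [Omega]. *)
Definition mixed_vectors : set E :=
  [set z | exists h w, [/\ true \in w, false \in w & z = ew h w]].

(* For such h, the annihilation and creation operators of the i-th algebra
   vanish on (A i h) (x) T(K). *)
Definition annihilated i (h : H) : Prop :=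
  forall c, A i c -> dot (c h) omega = 0.

(* Modulo mixed words, [f] acts as [a (x) Id] on the two kinds of vectors met
   along an alternating centered product. *)
Definition compression i (f : E -> E) (a : H -> H) : Prop :=
  [/\ A i a,
      forall h, f (inl_ds E h) = inl_ds E (a h),
      forall z, hull mixed_vectors z -> hull mixed_vectors (f z),
      forall h k, hull mixed_vectors
        (f (ew h (nseq k.+1 (~~ i))) - ew (a h) (nseq k.+1 (~~ i))) &
      forall h k, annihilated i h ->
        f (ew h (nseq k.+1 i)) = ew (a h) (nseq k.+1 i)].

Lemma mixed_hull h w : true \in w -> false \in w -> hull mixed_vectors (ew h w).
Proof. by move=> tw fw; apply: sub_hull; exists h, w. Qed.

Lemma mixed_neq_nseq i n (w : seq bool) :
  true \in w -> false \in w -> (w == nseq n i) = false.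
Proof.
move=> tw fw; apply/eqP => wE; move: tw fw; rewrite wE !mem_nseq.
by case: i {wE} => /andP[_ ?] /andP[_ ?].
Qed.

Lemma dot_hull_mixed_Omega z : hull mixed_vectors z -> dot z (Omega omega E) = 0.
Proof.
apply: hull_dot0 => _ [h [w [tw fw ->]]].
by rewrite (Omega_ew omega E eta) dot_ew// (mixed_neq_nseq true 0 tw fw) mulr0.
Qed.

Lemma annihilated_id i h : annihilated i h -> dot h omega = 0.
Proof. by case: (A_unital i) => _ Aid /(_ _ Aid). Qed.

(** An operator $\pi(a)$ compresses to [a], creation and annihilation operators compress to 0, and
    the property passes to sums, multiples and products. *)
Lemma compression_exists i f : frak i f ->
  bounded_operator f /\ exists a, compression i f a.
Proof.
have [[Ab A0 AD AZ AM] Aid] := A_unital i.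
have ew0 w : ew 0 w = 0 := linear_fun0 (ew_linear E eta w).
have inl0 : inl_ds E 0 = 0 := linear_fun0 (inl_ds_linear E).
apply: (@frak_ind i (fun f => exists a, compression i f a)) => {f}.
- move=> a P Aa piP; have [[lP _] Pinl _ _] := piP.
  have Pew := is_pi_ew eta_orthonormal piP.
  exists a; split => //.
  + move=> z; apply: (hull_map lP) => _ [h [w [tw fw ->]]].
    by rewrite Pew; [apply: mixed_hull | apply: contraTneq tw => ->].
  + by move=> h k; rewrite Pew// subrr; apply: hull0.
  + by move=> h k _; rewrite Pew.
- move=> P crP; have [[lP _] Pinl _ _] := crP.
  have Pew := is_creation_ew omega1 crP.
  exists (fun=> 0); split => //.
  + by move=> h; rewrite Pinl inl0.
  + move=> z; apply: (hull_map lP) => _ [h [w [tw fw ->]]].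
    by rewrite Pew; apply: hullZ; apply: mixed_hull; rewrite inE ?tw ?fw orbT.
  (* Prepending [i] to a nonempty power of the other letter gives a mixed word. *)
  + move=> h k; rewrite Pew ew0 subr0; apply: hullZ; apply: mixed_hull;
    by rewrite !inE; case: (i).
  + by move=> h k /annihilated_id h0; rewrite Pew h0 scale0r ew0.
- move=> n P anP; have [[lP _] _ _] := anP.
  have Pew := is_annihilation_ew omega1 eta_orthonormal anP.
  exists (fun=> 0); split => //.
  + by move=> h; rewrite (is_annihilation_inl omega1 eta_orthonormal anP) inl0.
  + move=> z; apply: (hull_map lP) => _ [h [w [tw fw ->]]].
    by rewrite Pew mixed_neq_nseq// mulr0 scale0r; apply: hull0.
  (* The word is nonempty, which settles [n = 0]; for larger [n] the first letters differ. *)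
  + move=> h k; rewrite Pew ew0 subr0 [_ == _](_ : _ = false); last first.
      by case: n {anP Pew} => [|n]//=; rewrite eqseq_cons; case: (i).
    by rewrite mulr0 scale0r; apply: hull0.
  + by move=> h k /annihilated_id h0; rewrite Pew h0 mul0r scale0r ew0.
- exists (fun=> 0); split => //.
  + by move=> *; apply: hull0.
  + by move=> h k; rewrite ew0 subr0; apply: hull0.
- move=> f g _ _ [a [Aa f1 f2 f3 f4]] [b [Ab' g1 g2 g3 g4]].
  exists (fun h => a h + b h); split.
  + exact: AD.
  + by move=> h; rewrite f1 g1 (linear_funD _ _ (inl_ds_linear E)).
  + by move=> z hz; apply: hullD; [apply: f2 | apply: g2].
  + move=> h k; rewrite (linear_funD _ _ (ew_linear E eta _)) opprD addrACA.
    by apply: hullD; [apply: f3 | apply: g3].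
  + by move=> h k hi; rewrite f4// g4// (linear_funD _ _ (ew_linear E eta _)).
- move=> c f _ [a [Aa f1 f2 f3 f4]].
  exists (fun h => c *: a h); split.
  + exact: AZ.
  + by move=> h; rewrite f1 (linear_funZ _ _ (inl_ds_linear E)).
  + by move=> z hz; apply: hullZ; apply: f2.
  + move=> h k; rewrite (linear_funZ _ _ (ew_linear E eta _)) -scalerBr.
    by apply: hullZ; apply: f3.
  + by move=> h k hi; rewrite f4// (linear_funZ _ _ (ew_linear E eta _)).
- move=> f g [lf _] _ [a [Aa f1 f2 f3 f4]] [b [Ab' g1 g2 g3 g4]].
  exists (a \o b); split.
  + exact: AM.
  + by move=> h /=; rewrite g1 f1.
  + by move=> z hz; apply/f2/g2.
  (* The error of [g] is mixed and stays so under [f]; the rest is the error of [f] at [b h]. *)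
  + move=> h k /=; rewrite -(subrK (ew (b h) (nseq k.+1 (~~ i))) (g _)).
    rewrite (linear_funD _ _ lf) -addrA; apply: hullD; last exact: f3.
    exact/f2/g3.
  (* [b h] is annihilated too, since [c \o b] lies in [A i]. *)
  + move=> h k hi /=; rewrite g4// f4// => c Ac.
    exact: (hi (c \o b)) (AM _ _ Ac Ab').
Qed.

(** [g] records the product of the letters already applied; the exponent [k.+1] keeps these vectors
    orthogonal to [Omega]. *)
Definition orbit_vectors i (g : H -> H) : set E :=
  [set z | exists b k, A i b /\ z = ew (g (b omega)) (nseq k.+1 i)].

(** The span of [Omega] and the orbit vectors is invariant under each generator, hence under the
    whole [i]-th algebra. *)
Lemma frak_Omega i f : frak i f -> exists c, exists2 v,
  hull (orbit_vectors i id) v & f (Omega omega E) = c *: Omega omega E + v.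
Proof.
have [_ Aid] := A_unital i; have [[Ab _ _ _ AM] _] := A_unital i.
pose S := orbit_vectors i id `|` [set Omega omega E].
have SOmega : hull S (Omega omega E) by apply: sub_hull; right.
have Sew b k : A i b -> hull S (ew (b omega) (nseq k.+1 i)).
  by move=> Ab'; apply: sub_hull; left; exists b, k.
move=> /(@frak_ind i (fun f => forall z, hull S z -> hull S (f z))) fS.
apply: hull_insert; apply: (proj2 (fS _ _ _ _ _ _ _)) => {f fS} //.
- move=> a P Aa piP z; have [[lP _] _ _ _] := piP.
  apply: (hull_map lP) => _ [[b [k [Ab' ->]]]|->].
    rewrite (is_pi_ew eta_orthonormal piP)//.
    by apply: (Sew (a \o b)); apply: AM.
  by rewrite (is_pi_Omega _ piP); apply: hull0.
- move=> P crP z; have [[lP _] _ _ _] := crP.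
  have Pew := is_creation_ew omega1 crP.
  apply: (hull_map lP) => _ [[b [k [Ab' ->]]]|->].
    (* Creation replaces [b omega] by a multiple of [omega], hence the witness [id], and adds one
       letter. *)
    by rewrite Pew; apply: hullZ; apply: (Sew id k.+1).
  by rewrite (Omega_ew omega E eta) Pew; apply: hullZ; apply: (Sew id 0%N).
- move=> n P /(is_annihilation_dot omega1 eta_orthonormal) Pz z _.
  by rewrite Pz; apply: hullZ.
- by move=> *; apply: hull0.
- by move=> f g _ _ fS gS z zS; apply: hullD; [apply: fS | apply: gS].
- by move=> c f _ fS z zS; apply/hullZ/fS.
- by move=> f g _ _ fS gS z zS; apply/fS/gS.
Qed.

Lemma dot_orbit_Omega i g z :
  hull (orbit_vectors i g) z -> dot z (Omega omega E) = 0.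
Proof.
apply: hull_dot0 => _ [b [k [_ ->]]].
by rewrite (Omega_ew omega E eta) dot_ew// mulr0.
Qed.

(** * Alternating centered products *)

Hypothesis A_free : free_family (vector_functional omega) A.

(** Induction on the outermost letter [x 0]. It acts through [a 0] on pure powers of [i]: up to
    mixed vectors if its label is not [i], and exactly otherwise, because freeness makes the current
    vector annihilated. *)
Lemma alternating_prefix_orbit n i eps (x : nat -> E -> E) (a : nat -> H -> H) :
  (forall j, (j < n)%N -> bounded_operator (x j)) ->
  (forall j, (j < n)%N -> compression (eps j) (x j) (a j)) ->
  (forall j, (j < n)%N -> dot (a j omega) omega = 0) ->
  (forall k, (k.+1 < n)%N -> eps k <> eps k.+1) ->
  ((0 < n)%N -> eps n.-1 = ~~ i) ->
  forall z, hull (orbit_vectors i id) z ->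
    hull (orbit_vectors i (op_prod n a) `|` mixed_vectors) (op_prod n x z).
Proof.
elim: n eps x a => [|n IH] eps x a xb xa a0 alte epsn z hz.
  by rewrite !op_prod0; apply: hull_sub hz => u; left.
rewrite (op_prodSl n x) /=.
have [lx _] := xb 0%N isT.
have [a0A xinl xmix xother xself] := xa 0%N isT.
have : hull (orbit_vectors i (op_prod n (a \o succn)) `|` mixed_vectors)
    (op_prod n (x \o succn) z).
  apply: (IH (eps \o succn)) hz.
  - by move=> j jn; apply: xb.
  - by move=> j jn; apply: xa.
  - by move=> j jn; apply: a0.
  - by move=> j jn; apply: alte.
  - by case: (n) epsn => // m; apply.
apply: (hull_map lx).
move=> s [[b [k [Ab ->]]]|mz]; last first.
  by apply: hull_sub (xmix _ (sub_hull mz)) => u; right.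
set y := op_prod n (a \o succn) (b omega).
have gE : a 0%N y = op_prod n.+1 a (b omega) by rewrite op_prodSl.
have Sa : hull (orbit_vectors i (op_prod n.+1 a) `|` mixed_vectors)
    (ew (a 0%N y) (nseq k.+1 i)).
  by rewrite gE; apply: sub_hull; left; exists b, k.
have [e0|e0] := eqVneq (eps 0%N) i.
  (* The first label is [i] and the last is [~~ i], so some letter follows [x 0]. *)
  have n0 : (0 < n)%N.
    by case: (n) epsn => // /(_ isT) /=; rewrite e0; case: (i).
  (* It remains to see that [y] is annihilated: [c y] is a word starting and ending in the other
     algebra, between [c] and [b]. *)
  rewrite e0 in xself; rewrite xself// => c Ac.
  apply: (free_word_two_sided omega1 A_unital A_free (eps := eps \o succn) _ _ _
    Ab Ac) => /=.
  - split=> // j jn; last exact: alte.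
      by have [] := xa j.+1 jn.
    exact: a0.
  - have : eps 0%N <> eps 1%N by apply: alte.
    by rewrite e0; case: (eps 1%N) (i) => [] [].
  - by case: (n) epsn n0 => // m; apply.
have ei : ~~ eps 0%N = i by case: (eps 0%N) (i) e0 => [] [].
rewrite -[x 0%N _](subrK (ew (a 0%N y) (nseq k.+1 i))) addrC.
apply: hullD => //; apply: (@hull_sub _ _ mixed_vectors); first by move=> u; right.
by have := xother y k; rewrite ei.
Qed.

(** On the summand [H] each letter restricts to its compression, so freeness of the [A i]
    transfers. *)
Lemma frak_free :
  free_family (vector_functional (inl_ds E omega)) (fun i => frak i).
Proof.
move=> n eps x [n0 xB x0 alte].
have /choice[a xa] j : exists a, (j < n)%N -> compression (eps j) (x j) a.
  case: (ltnP j n) => jn; last by exists id.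
  by have [_ [a xa]] := compression_exists (xB j jn); exists a.
have psiE y b : (forall h, y (inl_ds E h) = inl_ds E (b h)) ->
    vector_functional (inl_ds E omega) y = vector_functional omega b.
  by move=> yb; rewrite /vector_functional yb dot_inl_inl.
rewrite (psiE _ (op_prod n a)).
  apply: (@A_free n eps); split => // j jn; first by case: (xa j jn).
  by rewrite -(psiE (x j)) ?x0//; case: (xa j jn).
have {}xa j : (j < n)%N -> forall h, x j (inl_ds E h) = inl_ds E (a j h).
  by move=> jn; case: (xa j jn).
elim: n x a xa {n0 xB x0 alte psiE} => [|n IH] x a xa h.
  by rewrite !op_prod0.
by rewrite !op_prodSl /= (IH _ (a \o succn)) ?xa// => j jn k; apply: (xa j.+1).
Qed.

Lemma frak_cfree : cfree_family (vector_functional (Omega omega E))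
  (vector_functional (inl_ds E omega)) (fun i => frak i).
Proof.
split; first exact: frak_free.
move=> n eps x [_ xB x0 alte].
have /choice[a xa] j : exists a, (j < n)%N -> compression (eps j) (x j) a.
  case: (ltnP j n) => jn; last by exists id.
  by have [_ [a xa]] := compression_exists (xB j jn); exists a.
have xb j : (j < n)%N -> bounded_operator (x j).
  by move=> jn; have [] := compression_exists (xB j jn).
have a0 j : (j < n)%N -> dot (a j omega) omega = 0.
  move=> jn; rewrite -(x0 j jn) /vector_functional.
  by have [_ -> _ _ _] := xa j jn; rewrite dot_inl_inl.
have OmegaOmega : dot (Omega omega E) (Omega omega E) = 1.
  by rewrite (Omega_ew omega E eta) dot_ew// omega1 mulr1.
(* The induction removes the last letter and starts at the empty product, where both sides are 1. *)
elim: n xB {x0} alte xa xb a0 => [|n IH] xB alte xa xb a0.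
  by rewrite op_prod0 big_ord0 /vector_functional.
rewrite op_prodSr big_ord_recr /= -IH; first last.
- by move=> j jn; apply/a0/ltnW.
- by move=> j jn; apply/xb/ltnW.
- by move=> j jn; apply/xa/ltnW.
- by move=> k kn; apply/alte/ltnW.
- by move=> j jn; apply: (xB j (ltnW jn)).
(* As [v] is orthogonal to [Omega], the scalar [c] is the value of $\phi$ at [x n]. *)
have [c [v hv xO]] := frak_Omega (xB n (ltnSn n)).
have lx : linear (op_prod n x).
  by apply: linear_op_prod => j jn; have [] := xb j (ltnW jn).
rewrite /vector_functional /= xO lx !dotDl !dotZl OmegaOmega mulr1.
rewrite (dot_orbit_Omega hv) addr0 mulrC.
(* The prefix sends [v] to orbit and mixed vectors, all orthogonal to [Omega]. *)
rewrite [dot (op_prod n x v) _](_ : _ = 0) ?addr0//.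
apply: hull_dot0
  (alternating_prefix_orbit (i := eps n) (eps := eps) (a := a) _ _ _ _ _ hv).
- move=> u [uo|um]; [apply: dot_orbit_Omega (sub_hull uo) | ].
  exact: dot_hull_mixed_Omega (sub_hull um).
- by move=> j jn; apply/xb/ltnW.
- by move=> j jn; apply/xa/ltnW.
- by move=> j jn; apply/a0/ltnW.
- by move=> k kn; apply/alte/ltnW.
- move=> n0; have := alte n.-1; rewrite prednK// => /(_ (ltnSn n)).
  by case: (eps n.-1) (eps n) => [] [].
Qed.

End Compression.

Theorem theorem2p6 (R : realType) (H K : hilbert R) (omega : H)
    (T : fock_space K) (HT : tensor_product H T) (E : direct_sum H HT)
    (A1 A2 : set (H -> H)) (eta1 eta2 : K) :
  `|omega| = 1 ->
  unital_subalgebra A1 ->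
  unital_subalgebra A2 ->
  free_family (vector_functional omega) (fun b : bool => if b then A1 else A2) ->
  `|eta1| = 1 ->
  `|eta2| = 1 ->
  dot eta1 eta2 = 0 ->
  cfree_family (vector_functional (Omega omega E))
        (vector_functional (inl_ds E omega))
        (fun b : bool =>
           if b then frakA omega E A1 eta1 else frakA omega E A2 eta2).
Proof.
move=> omega1 A1u A2u A12 eta1u eta2u eta12.
pose A b := if b then A1 else A2; pose eta b := if b then eta1 else eta2.
(* Moves the case distinction inside [frakA], the form treated by [frak_cfree]. *)
rewrite (_ : (fun b => _) = fun b => frakA omega E (A b) (eta b)); last first.
  by apply/funext => -[].
apply: frak_cfree => //.
- exact: dot_unit.
- by move=> [] []; rewrite /eta ?dot_unit//; apply: dot_eq0C.
- by case.
Qed.
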